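(* Let $(\lambda_N)_{N\ge 1}$ be a sequence in $[0,1]$ with $\lambda_N=o\left(\frac{1}{\sqrt N}\right)$ as $N\to\infty$. Then for all $N$ big enough, the $1$-step self-financing strategy $\phi^{N}(\lambda_N,N)$ (the strategy $\phi^N(\lambda,n_0)$ of the context with $\lambda=\lambda_N$ and $n_0=N$) is a $\lambda_N$-arbitrage in the $N$-fractional binary market.
   Context: Fix $H\in(1/2,1)$, $\sigma>0$, $s_0>0$. Let $(\xi_i)_{i\ge1}$ be i.i.d. with $P(\xi_1=1)=P(\xi_1=-1)=1/2$, $\mathcal F_i=\sigma(\xi_1,\dots,\xi_i)$ ($\mathcal F_0$ and $\mathcal F_{-1}$ trivial). Set $c_H=\sqrt{\frac{2H\,\Gamma(\frac32-H)}{\Gamma(H+\frac12)\,\Gamma(2-2H)}}$ and, for $n\ge1$, $1\le i\le n-1$, $$j_n(i)=\sigma c_H\left(H-\tfrac12\right)\int_{i-1}^{i}x^{\frac12-H}\left(\int_0^1 (v+n-1)^{H-\frac12}(v+n-1-x)^{H-\frac32}\,dv\right)dx,$$ $$g_n=\sigma c_H\left(H-\tfrac12\right)\int_{n-1}^{n}x^{\frac12-H}(n-x)^{H-\frac12}\left(\int_0^1 (y(n-x)+x)^{H-\frac12}y^{H-\frac32}\,dy\right)dx,$$ and $X_n=\sum_{i=1}^{n-1}j_n(i)\xi_i+g_n\xi_n$. The $N$-fractional binary market ($N>1$, without drift) has bond identically $1$ and stock $S^{(N)}_0=s_0$, $S_n^{(N)}=\left(1+\frac{X_n}{N^H}\right)S_{n-1}^{(N)}$,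 $1\le n\le N$, adapted to $(\mathcal F_n)_{n=0}^N$. For $\lambda\in[0,1]$, a $\lambda$-self-financing strategy for $S=(S_n)_{n=0}^N$ is an adapted process $\phi=(\phi^0_n,\phi^1_n)_{n=-1}^N$ with, for all $n\in\{0,\dots,N\}$, $$\phi_n^0-\phi_{n-1}^0\le -(\phi_n^1-\phi_{n-1}^1)^+S_n+(1-\lambda)(\phi_n^1-\phi_{n-1}^1)^-S_n.$$ Its liquidation value is $V_n^\lambda(\phi)=\phi_n^0+(1-\lambda)(\phi_n^1)^+S_n-(\phi_n^1)^-S_n$. It is a $\lambda$-arbitrage if $(\phi^0_{-1},\phi^1_{-1})=(0,0)$, $V_N^\lambda(\phi)\ge0$ a.s. and $P(V_N^\lambda(\phi)>0)>0$. Let $n_H\ge1$ be an integer such that $-\sum_{i=1}^{n-1}j_n(i)+g_n<0$ for all $n\ge n_H$ (such an integer exists, by a known result of Sottinen). Write $\vec\xi_k=(\xi_1,\dots,\xi_k)$ and $\vec 1_k=(1,\dots,1)\in\mathbb R^k$. For $\lambda\in[0,1]$, $N\ge n_H$ and $n_0\in\{n_H,\dots,N\}$, the strategy $\phi^N(\lambda,n_0)=(\phi^{N,0}(\lambda,n_0),\phi^{N,1}(\lambda,n_0))$ is defined, with $E=\{\vec\xi_{n_0-1}=-\vec1_{n_0-1}\}$, by: - $\phi^{N,0}_i=\phi^{N,1}_i=0$ for $i\le n_0-2$; - $\phi^{N,0}_{n_0-1}=(1-\lambda)S^{(N)}_{n_0-1}\mathbf 1_{E}$, $\phi^{N,1}_{n_0-1}=-\mathbf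 1_E$; - $\phi^{N,0}_{n}=\left((1-\lambda)S^{(N)}_{n_0-1}-S^{(N)}_{n_0}\right)\mathbf 1_{E}$, $\phi^{N,1}_{n}=0$ for $n_0\le n\le N$. *)

(* Defs.v *)
From HB Require Import structures.
From mathcomp Require Import all_boot all_order all_algebra.
From mathcomp Require Import all_classical all_reals all_analysis.

Set Implicit Arguments.
Unset Strict Implicit.
Unset Printing Implicit Defensive.

Import Order.TTheory GRing.Theory Num.Theory.
Import numFieldNormedType.Exports.

Local Open Scope classical_set_scope.
Local Open Scope ring_scope.

Section Kernels.
Context {R : realType}.
Local Notation mu := (@lebesgue_measure R).

Definition Gamma (a : R) : R :=
  \int[mu]_(t in `]0, +oo[) (t `^ (a - 1) * expR (- t)).

Definition cH (H : R) : R :=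
  Num.sqrt ((2 * H * Gamma (3 / 2 - H)) / (Gamma (H + 1 / 2) * Gamma (2 - 2 * H))).

(* Real-valued Lebesgue integrals. All powers have nonnegative bases on the
   integration domains; the value of powR at base 0 only matters on null sets. *)
Definition j (H sigma : R) (n i : nat) : R :=
  sigma * cH H * (H - 1 / 2) *
  \int[mu]_(x in `[i%:R - 1, i%:R])
    (x `^ (1 / 2 - H) *
     \int[mu]_(v in `[0, 1])
       ((v + n%:R - 1) `^ (H - 1 / 2) * (v + n%:R - 1 - x) `^ (H - 3 / 2))).

Definition g (H sigma : R) (n : nat) : R :=
  sigma * cH H * (H - 1 / 2) *
  \int[mu]_(x in `[n%:R - 1, n%:R])
    (x `^ (1 / 2 - H) * (n%:R - x) `^ (H - 1 / 2) *
     \int[mu]_(y in `[0, 1])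
       ((y * (n%:R - x) + x) `^ (H - 1 / 2) * y `^ (H - 3 / 2))).

End Kernels.

Section Probability.
Context {R : realType} {d : measure_display} {T : measurableType d}.
Context {P : probability T R}.

Definition independent_RVs (I : set nat) (xi : nat -> {RV P >-> R}) : Prop :=
  forall (J : seq nat) (B : nat -> set R),
    uniq J -> [set` J] `<=` I -> (forall i, measurable (B i)) ->
    P (\bigcap_(i in [set` J]) xi i @^-1` B i) =
    (\prod_(i <- J) P (xi i @^-1` B i))%E.

(* xi 0 is unconstrained: the sequence of the model starts at index 1. *)
Definition iid_signs (xi : nat -> {RV P >-> R}) : Prop :=
  (forall i, (1 <= i)%N ->
     P (xi i @^-1` [set 1]) = (1 / 2)%:E /\
     P (xi i @^-1` [set -1]) = (1 / 2)%:E) /\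
  independent_RVs [set i | (1 <= i)%N] xi.

(* Times are integers since strategies start at time -1; the sigma-algebra is
   generated by no variable at all, hence trivial, for n <= 0. *)
Definition filtration_of (xi : nat -> {RV P >-> R}) (n : int) : set (set T) :=
  <<s \bigcup_(i in [set i : nat | (1 <= i)%N /\ i%:Z <= n])
        g_sigma_algebra_preimage (xi i) >>.

End Probability.

Section Market.
Context {R : realType} {d : measure_display} {T : measurableType d}.

Record strategy := Strategy {
  bond : int -> T -> R ;
  stock : int -> T -> R }.

Definition adapted (F : int -> set (set T)) (N : nat) (Y : int -> T -> R) : Prop :=
  forall n : int, -1 <= n <= N%:Z ->
    forall B : set R, measurable B -> F n (Y n @^-1` B).

Definition pos_part (x : R) : R := Num.max x 0.
Definition neg_part (x : R) : R := Num.max (- x) 0.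

Definition self_financing (F : int -> set (set T)) (N : nat) (S : nat -> T -> R)
    (lambda : R) (phi : strategy) : Prop :=
  [/\ adapted F N (bond phi),
      adapted F N (stock phi) &
      forall (n : nat) (w : T), (n <= N)%N ->
        let dstock := stock phi n%:Z w - stock phi (n%:Z - 1) w in
        bond phi n%:Z w - bond phi (n%:Z - 1) w <=
          - pos_part dstock * S n w + (1 - lambda) * neg_part dstock * S n w].

Definition liquidation (S : nat -> T -> R) (lambda : R) (phi : strategy)
    (n : nat) (w : T) : R :=
  bond phi n%:Z w + (1 - lambda) * pos_part (stock phi n%:Z w) * S n w
  - neg_part (stock phi n%:Z w) * S n w.

Definition is_arbitrage (P : probability T R) (F : int -> set (set T)) (N : nat)
    (S : nat -> T -> R) (lambda : R) (phi : strategy) : Prop :=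
  [/\ self_financing F N S lambda phi,
      forall w, bond phi (-1) w = 0 /\ stock phi (-1) w = 0,
      {ae P, forall w, 0 <= liquidation S lambda phi N w} &
      (0 < P [set w | (0 < liquidation S lambda phi N w)%R])%E].

End Market.

Section FractionalBinaryMarket.
Context {R : realType} {d : measure_display} {T : measurableType d}.
Context {P : probability T R}.
Variables (H sigma s0 : R) (xi : nat -> {RV P >-> R}).

Definition X (n : nat) (w : T) : R :=
  \sum_(1 <= i < n) j H sigma n i * xi i w + g H sigma n * xi n w.

Fixpoint fbm_stock (N n : nat) (w : T) : R :=
  match n with
  | 0 => s0
  | m.+1 => (1 + X m.+1 w / N%:R `^ H) * fbm_stock N m w
  end.

Definition all_down (k : nat) : set T :=
  [set w | forall i : nat, (1 <= i <= k)%N -> xi i w = -1].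

(* Meant for 1 <= n0 <= N, so that n0.-1 is the time n0 - 1. *)
Definition phiN (N : nat) (lambda : R) (n0 : nat) : strategy :=
  let E := all_down n0.-1 in
  let S := fbm_stock N in
  {| bond := fun n w =>
       if n <= n0%:Z - 2 then 0
       else if n == n0%:Z - 1 then (1 - lambda) * S n0.-1 w * \1_E w
       else ((1 - lambda) * S n0.-1 w - S n0 w) * \1_E w ;
     stock := fun n w =>
       if n == n0%:Z - 1 then - \1_E w else 0 |}.

End FractionalBinaryMarket.

(* Main.v *)
Require Import Defs.
From HB Require Import structures.
From mathcomp Require Import all_boot all_order all_algebra.
From mathcomp Require Import all_classical all_reals all_analysis.
From mathcomp Require Import measurable_realfun zify lra ring.

Import Order.TTheory GRing.Theory Num.Theory.
Import numFieldNormedType.Exports.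

Local Open Scope classical_set_scope.
Local Open Scope ring_scope.

(* Write [a = H - 1/2] and [K = sigma c_H a]. On the event that the first [N - 1] signs
   are [-1], the strategy gains [S_(N-1) (- lambda_N - X_N / N^H)] with
   [- X_N >= sum_i j_N(i) - g_N]. Bounding the integrands pointwise gives
   [sum_i j_N(i) >= K N^a / 4] while [g_N <= 2 K / a], so the gain is positive as soon as
   [lambda_N] is below a small multiple of [N^a / N^H = N^(-1/2)]. The price [S_(N-1)] is
   positive because [sum_(i<n) j_n(i) + g_n = O(n^(2a))] and [2a < H]. *)

(** * Monotonicity of integrals, and integrals of powers on [[0, 1]] *)

(** The integral of a nonnegative function is a supremum over the simple functions below it, and
    every simple function below [f] is also below [g]. *)
Lemma ge0_le_integral_nonmeasurable {d} {T : measurableType d} {R : realType}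
    (mu : {measure set T -> \bar R}) (D : set T) (f g : T -> \bar R) :
  (forall x, D x -> (0 <= f x)%E) -> (forall x, D x -> (f x <= g x)%E) ->
  (\int[mu]_(x in D) f x <= \int[mu]_(x in D) g x)%E.
Proof.
move=> f0 fg.
have g0 x : D x -> (0 <= g x)%E by move=> Dx; exact: le_trans (f0 _ Dx) (fg _ Dx).
rewrite !ge0_integralE//; apply: ereal_sup_le => _ [h /= hf <-].
by exists h => //= x; apply: le_trans (hf x) _; exact: lee_restrict.
Qed.

(* [f] and [g] need not be measurable: this dispenses with the measurability of
   parametrized integrals in iterated integrals. *)
Lemma ge0_le_Rintegral {d} {T : measurableType d} {R : realType}
    (mu : {measure set T -> \bar R}) (D : set T) (f g h : T -> R) :
  measurable D -> mu.-integrable D (EFin \o h) ->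
  (forall x, D x -> [/\ 0 <= f x, f x <= g x & g x <= h x]) ->
  \int[mu]_(x in D) f x <= \int[mu]_(x in D) g x.
Proof.
move=> mD ih fgh.
have f0 x : D x -> (0 <= (f x)%:E)%E by move=> /fgh[]; rewrite lee_fin.
have fg x : D x -> ((f x)%:E <= (g x)%:E)%E by move=> /fgh[]; rewrite lee_fin.
have gh x : D x -> ((g x)%:E <= (h x)%:E)%E by move=> /fgh[]; rewrite lee_fin.
have g0 x : D x -> (0 <= (g x)%:E)%E.
  by move=> Dx; exact: le_trans (f0 _ Dx) (fg _ Dx).
have intfg := ge0_le_integral_nonmeasurable mu D _ _ f0 fg.
have intgh := ge0_le_integral_nonmeasurable mu D _ _ g0 gh.
have hfin := integrable_fin_num mD ih.
have gfin : (\int[mu]_(x in D) (g x)%:E)%E \is a fin_num.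
  rewrite ge0_fin_numE; last exact: integral_ge0.
  by apply: le_lt_trans intgh _; rewrite ltey_eq hfin.
apply: fine_le => //; rewrite ge0_fin_numE; last exact: integral_ge0.
by apply: le_lt_trans intfg _; rewrite ltey_eq gfin.
Qed.

Lemma integrable_cst_itv {R : realType} (a b c : R) :
  (@lebesgue_measure R).-integrable `[a, b] (EFin \o cst c).
Proof.
apply: measurable_bounded_integrable => //=.
- by rewrite lebesgue_measure_itv/=; case: ifP => _; rewrite ?ltry// -EFinB ltry.
- exact: bounded_cst.
Qed.

Lemma Rintegral_cst_itv {R : realType} (a b c : R) : a <= b ->
  \int[@lebesgue_measure R]_(x in `[a, b]) c = c * (b - a).
Proof.
move=> ab; rewrite Rintegral_cst//= lebesgue_measure_itv/= lte_fin.
by case: ltP => //= ba; rewrite (@le_anti _ _ a b) ?ab// subrr.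
Qed.

(** For [b < 0] the integrand is singular at 0, so []0, 1]] is exhausted by the intervals
    [[e k, 1]]. On each of them the antiderivative [x^(b + 1) / (b + 1)] gives the bound, and
    monotone convergence carries it to the limit. *)
Lemma integral_powR01_le {R : realType} (b : R) : -1 < b ->
  (\int[@lebesgue_measure R]_(x in `]0%R, 1%R]) (x `^ b)%:E <= (b + 1)^-1%:E)%E.
Proof.
move=> b1; have c0 : 0 < b + 1 by lra.
(* The shift by 2 keeps [e k < 1] for [k = 0] as well: the fundamental theorem of calculus is
   applied on a nondegenerate interval. *)
pose e (k : nat) : R := k.+2%:R^-1.
have e0 k : 0 < e k by rewrite invr_gt0.
have e1 k : e k < 1 by rewrite invf_lt1// ltr1n.
have itvE : `]0, 1]%classic = \bigcup_k `[e k, 1]%classic :> set R.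
  apply/seteqP; split=> x /=; rewrite in_itv/=.
    move=> /andP[x0 x1].
    have [k _ kx] := near_infty_natSinv_lt (PosNum x0).
    exists k => //=; rewrite in_itv/= x1 andbT.
    have /= := kx k.+1 (leqnSn k); rewrite /e => /ltW; apply: le_trans.
    by rewrite lef_pV2 ?posrE// ler_nat.
  by move=> [k _] /=; rewrite in_itv/= => /andP[kx ->]; rewrite (lt_le_trans (e0 k)).
have powRP (x : R) : 0 < x -> x \in `]0, +oo[ by rewrite in_itv/= andbT.
have cont (r x : R) : 0 < x -> {for x, continuous (@powR R ^~ r)}.
  move=> x0; apply/differentiable_continuous/derivable1_diffP.
  exact: derivable_powR (powRP _ x0).
rewrite itvE.
have nde : nondecreasing_seq (fun k => `[e k, 1]%classic : set R).
  move=> m n mn; apply/subsetPset => x /=; rewrite !in_itv/= => /andP[mx ->].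
  by rewrite andbT (le_trans _ mx)// lef_pV2 ?posrE// ler_nat !ltnS.
have cvg : (\int[@lebesgue_measure R]_(x in `[e k, 1%R]%classic) (x `^ b)%:E)%E @[k --> \oo]
    --> (\int[@lebesgue_measure R]_(x in \bigcup_k `[e k, 1%R]%classic) (x `^ b)%:E)%E.
  apply: ge0_nondecreasing_set_cvg_integral => // [i|i x _]; last by rewrite lee_fin powR_ge0.
  by apply/measurable_EFinP; apply: measurable_funTS; exact: measurable_powR.
rewrite -(cvg_lim _ cvg)//; apply: lime_le.
  by apply/cvg_ex; eexists; exact: cvg.
apply: nearW => k.
rewrite (@continuous_FTC2 _ _ (fun x => (b + 1)^-1 * x `^ (b + 1)) _ _ (e1 k)).
- rewrite -EFinB lee_fin powR1 mulr1 gerBl.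
  by rewrite mulr_ge0 ?powR_ge0// invr_ge0 ltW.
- apply: continuous_in_subspaceT => x; rewrite inE/= in_itv/= => /andP[kx _].
  by apply: cont; exact: lt_le_trans (e0 k) kx.
- have dF x : 0 < x -> derivable (fun x => (b + 1)^-1 * x `^ (b + 1)) x 1.
    by move=> x0; apply: derivableM => //; exact: derivable_powR (powRP _ x0).
  have cF x : 0 < x -> {for x, continuous (fun x => (b + 1)^-1 * x `^ (b + 1))}.
    by move=> x0; apply/differentiable_continuous/derivable1_diffP; exact: dF.
  split.
  + by move=> x; rewrite in_itv/= => /andP[kx _]; apply: dF; exact: lt_trans kx.
  + by apply: cvg_at_right_filter; exact: cF.
  + by apply: cvg_at_left_filter; apply: cF.
- move=> x; rewrite in_itv/= => /andP[kx _].
  have x0 : 0 < x by exact: lt_trans kx.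
  rewrite derive1E deriveZ/=; last exact: derivable_powR (powRP _ x0).
  rewrite -derive1E powR_derive1 ?powRP// addrK.
  by rewrite /GRing.scale/= mulrA mulVf ?mul1r// gt_eqF.
Qed.

Lemma ler_powR_npos {R : realType} (r x y : R) :
  r <= 0 -> 0 < x -> x <= y -> y `^ r <= x `^ r.
Proof.
move=> r0 x0 xy; rewrite -(opprK r) (powRN y) (powRN x) lef_pV2 ?posrE ?powR_gt0//.
  by rewrite ge0_ler_powR ?oppr_ge0// nnegrE ltW// (lt_le_trans x0).
by rewrite (lt_le_trans x0).
Qed.

Lemma ler_powR_nneg {R : realType} (r x y : R) :
  0 <= r -> 0 <= x -> x <= y -> x `^ r <= y `^ r.
Proof. by move=> r0 x0 xy; rewrite ge0_ler_powR// nnegrE// (le_trans x0). Qed.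

Lemma integrable_powR01 {R : realType} (b : R) : -1 < b ->
  (@lebesgue_measure R).-integrable `[0, 1] (fun x => (x `^ b)%:E).
Proof.
move=> b1; apply/integrableP; split.
  by apply/measurable_EFinP; apply: measurable_funTS; exact: measurable_powR.
rewrite -integral_itv_obnd_cbnd; last first.
  apply: measurableT_comp => //.
  by apply/measurable_EFinP; apply: measurable_funTS; exact: measurable_powR.
under eq_integral => x _ do rewrite gee0_abs ?lee_fin ?powR_ge0//.
exact: le_lt_trans (integral_powR01_le _ b1) (ltry _).
Qed.

Lemma Rintegral_powR01_le {R : realType} (b : R) : -1 < b ->
  \int[@lebesgue_measure R]_(x in `[0, 1]) x `^ b <= (b + 1)^-1.
Proof.
move=> b1; rewrite -Rintegral_itv_obnd_cbnd; last first.
  apply: integrableS (integrable_powR01 _ b1) => //.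
  by apply: subset_itvr; rewrite bnd_simp.
apply: (@fine_le _ _ (_%:E)) => //; last exact: integral_powR01_le.
rewrite ge0_fin_numE; first exact: le_lt_trans (integral_powR01_le _ b1) (ltry _).
by apply: integral_ge0 => x _; rewrite lee_fin powR_ge0.
Qed.

(** * Integrals over unit intervals against the weight [x^(- a)] *)

Section weighted_integral.
Context {R : realType}.
Implicit Types (a c : R) (f : R -> R).
Local Notation mu := (@lebesgue_measure R).

Lemma Rintegral_powRN_le_far a c (i : nat) f : 0 <= a -> (2 <= i)%N ->
  (forall x, i%:R - 1 <= x <= i%:R -> 0 <= f x <= c) ->
  \int[mu]_(x in `[i%:R - 1, i%:R]) (x `^ (- a) * f x) <= (i%:R - 1) `^ (- a) * c.
Proof.
move=> a0 i2 fc; have i1 : 0 < i%:R - 1 :> R by rewrite subr_gt0 ltr1n.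
rewrite -[leRHS]mulr1 -[X in _ <= _ * X](_ : i%:R - (i%:R - 1) = 1); last by lra.
rewrite -Rintegral_cst_itv; last by lra.
apply: ge0_le_Rintegral (integrable_cst_itv _ _ ((i%:R - 1) `^ (- a) * c)) _ => //.
move=> x /=; rewrite in_itv/= => xi; have /andP[f0 fxc] := fc _ xi.
split => //; first by rewrite mulr_ge0// powR_ge0.
by rewrite ler_pM ?powR_ge0// ler_powR_npos ?oppr_le0//; case/andP: xi.
Qed.

(** The constant 2 covers both cases: for [i = 1] the weight has integral at most
    [1 / (1 - a) <= 2], and for [i >= 2] it is at most 1 on the interval. *)
Lemma Rintegral_powRN_le a c (i : nat) f : 0 <= a < 1 / 2 -> (1 <= i)%N ->
  (forall x, i%:R - 1 <= x <= i%:R -> 0 <= f x <= c) ->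
  \int[mu]_(x in `[i%:R - 1, i%:R]) (x `^ (- a) * f x) <= 2 * c.
Proof.
move=> /andP[a0 a12] i1 fc.
have c0 : 0 <= c.
  have /andP[f0] : 0 <= f i%:R <= c by apply: fc; lra.
  exact: le_trans.
case: i i1 fc => // -[_|i _] fc; last first.
  apply: le_trans (Rintegral_powRN_le_far _ c _ _ a0 _ fc) _ => //.
  apply: ler_wpM2r => //; rewrite powRN; apply: (@le_trans _ _ 1); last by lra.
  have i0 : 0 < i.+2%:R - 1 :> R by rewrite subr_gt0 ltr1n.
  rewrite invf_le1 ?powR_gt0//.
  by rewrite -[leLHS](powRr0 (i.+2%:R - 1)) ler_powR// lerBrDr -[leLHS]/(2%:R) ler_nat.
rewrite subrr in fc *.
apply: (@le_trans _ _ (\int[mu]_(x in `[0, 1]) (c * x `^ (- a)))).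
  have int : mu.-integrable `[0, 1] (EFin \o (fun x => c * x `^ (- a))).
    by apply: (integrableZl _ c (integrable_powR01 (- a) _)) => //; lra.
  apply: ge0_le_Rintegral int _ => // x /=; rewrite in_itv/= => x01.
  have /andP[f0 fxc] := fc _ x01.
  split => //; first by rewrite mulr_ge0// powR_ge0.
  by rewrite mulrC ler_wpM2r ?powR_ge0.
rewrite RintegralZl//; last by apply: integrable_powR01; lra.
rewrite mulrC; apply: ler_wpM2r => //.
apply: le_trans (Rintegral_powR01_le _ _) _; first by lra.
by rewrite -[leRHS]invrK lef_pV2 ?posrE; lra.
Qed.

(** The weight is at least its value at the right endpoint. The bound [c'] supplies the integrable
    majorant that [ge0_le_Rintegral] asks for, and [2 <= i] keeps the base [i - 1] positive. *)
Lemma Rintegral_powRN_ge a c c' (i : nat) f : 0 <= a -> (2 <= i)%N -> 0 <= c ->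
  (forall x, i%:R - 1 <= x <= i%:R -> c <= f x <= c') ->
  i%:R `^ (- a) * c <= \int[mu]_(x in `[i%:R - 1, i%:R]) (x `^ (- a) * f x).
Proof.
move=> a0 i2 c0 fc; have i1 : 0 < i%:R - 1 :> R by rewrite subr_gt0 ltr1n.
rewrite -[leLHS]mulr1 -[X in _ * X <= _](_ : i%:R - (i%:R - 1) = 1); last by lra.
rewrite -Rintegral_cst_itv; last by lra.
apply: (@ge0_le_Rintegral _ _ _ _ _ _ _ (cst ((i%:R - 1) `^ (- a) * c'))) => //.
  exact: integrable_cst_itv.
move=> x /=; rewrite in_itv/= => xi; have /andP[cf fc'] := fc _ xi.
move: xi => /andP[ix xi]; have x0 : 0 < x by exact: lt_le_trans ix.
split; first by rewrite mulr_ge0// powR_ge0.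
  by rewrite ler_pM ?powR_ge0// ler_powR_npos ?oppr_le0.
rewrite ler_pM ?powR_ge0//; first exact: le_trans cf.
by rewrite ler_powR_npos ?oppr_le0.
Qed.

End weighted_integral.

(** * The kernels without their constant factor, and bounds on the inner integrals *)

Section kernel_bounds.
Context {R : realType}.
Implicit Types (a x : R) (n i : nat).
Local Notation mu := (@lebesgue_measure R).

(* [a] stands for [H - 1/2]; see [jE] and [gE]. *)
Definition j_inner a n x : R :=
  \int[mu]_(v in `[0, 1]) ((v + n%:R - 1) `^ a * (v + n%:R - 1 - x) `^ (a - 1)).

Definition j_kernel a n i : R :=
  \int[mu]_(x in `[i%:R - 1, i%:R]) (x `^ (- a) * j_inner a n x).

Definition g_inner a n x : R :=
  \int[mu]_(y in `[0, 1]) ((y * (n%:R - x) + x) `^ a * y `^ (a - 1)).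

Definition g_kernel a n : R :=
  \int[mu]_(x in `[n%:R - 1, n%:R]) (x `^ (- a) * (n%:R - x) `^ a * g_inner a n x).

Lemma jE (H sigma : R) n i :
  j H sigma n i = sigma * cH H * (H - 1 / 2) * j_kernel (H - 1 / 2) n i.
Proof. by rewrite /j_kernel /j_inner (_ : H - 1 / 2 - 1 = H - 3 / 2) ?opprB//; lra. Qed.

Lemma gE (H sigma : R) n :
  g H sigma n = sigma * cH H * (H - 1 / 2) * g_kernel (H - 1 / 2) n.
Proof. by rewrite /g_kernel /g_inner (_ : H - 1 / 2 - 1 = H - 3 / 2) ?opprB//; lra. Qed.

Lemma j_inner_ge0 a n x : 0 <= j_inner a n x.
Proof. by apply: Rintegral_ge0 => v _; rewrite mulr_ge0 ?powR_ge0. Qed.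

Lemma g_inner_ge0 a n x : 0 <= g_inner a n x.
Proof. by apply: Rintegral_ge0 => v _; rewrite mulr_ge0 ?powR_ge0. Qed.

Lemma j_kernel_ge0 a n i : 0 <= j_kernel a n i.
Proof. by apply: Rintegral_ge0 => v _; rewrite mulr_ge0 ?powR_ge0 ?j_inner_ge0. Qed.

Lemma g_kernel_ge0 a n : 0 <= g_kernel a n.
Proof.
by apply: Rintegral_ge0 => v _; rewrite mulr_ge0 ?g_inner_ge0// mulr_ge0 ?powR_ge0.
Qed.

Lemma integrable_cst_powR01 a c : 0 < a ->
  mu.-integrable `[0, 1] (EFin \o (fun v => c * v `^ (a - 1))).
Proof.
by move=> a0; apply: (integrableZl _ c (integrable_powR01 (a - 1) _)) => //; lra.
Qed.

Lemma Rintegral_cst_powR01_le a c : 0 < a -> 0 <= c ->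
  \int[mu]_(v in `[0, 1]) (c * v `^ (a - 1)) <= c / a.
Proof.
move=> a0 c0; rewrite RintegralZl//; last by apply: integrable_powR01; lra.
rewrite ler_wpM2l//; apply: le_trans (Rintegral_powR01_le _ _) _; first by lra.
by rewrite subrK.
Qed.

(** As [x <= n - 1], the second base is at least [v]. For [0 < v <= 1] the integrand is thus at most
    [n^a v^(a - 1)], which is integrable up to the singularity. *)
Lemma j_inner_le a n x : 0 < a < 1 -> (1 <= n)%N -> x <= n%:R - 1 ->
  j_inner a n x <= n%:R `^ a / a.
Proof.
move=> /andP[a0 a1] n1 xn; have n1R : 1 <= n%:R :> R by rewrite ler1n.
pose h v : R := n%:R `^ a * v `^ (a - 1).
(* The point [v = 0] is removed because [powR] sets [0^(a - 1) = 0], so that [h] need not dominate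
   there. *)
have int : mu.-integrable `]0, 1] (EFin \o h).
  apply: integrableS (integrable_cst_powR01 a (n%:R `^ a) a0) => //.
  by apply: subset_itvr; rewrite bnd_simp.
have le_v v : 0 < v <= 1 ->
    (v + n%:R - 1) `^ a * (v + n%:R - 1 - x) `^ (a - 1) <= n%:R `^ a * v `^ (a - 1).
  move=> v01; rewrite ler_pM ?powR_ge0//.
    by rewrite ler_powR_nneg//; lra.
  by rewrite ler_powR_npos//; lra.
apply: le_trans (Rintegral_cst_powR01_le a _ a0 (powR_ge0 _ _)).
rewrite /j_inner -Rintegral_itv_obnd_cbnd; last first.
  apply: le_integrable int => //.
  - apply/measurable_EFinP; apply: measurable_funTS; apply: measurable_funM.
      apply: (@measurableT_comp _ _ _ _ _ _ (@powR R ^~ a)); [exact: measurable_powR|].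
      by apply: measurable_funB => //; exact: measurable_funD.
    apply: (@measurableT_comp _ _ _ _ _ _ (@powR R ^~ (a - 1))); [exact: measurable_powR|].
    by apply: measurable_funB => //; apply: measurable_funB => //; exact: measurable_funD.
  - move=> v /=; rewrite in_itv/= => v01; rewrite lee_fin.
    by rewrite !ger0_norm ?mulr_ge0 ?powR_ge0// le_v.
rewrite -[leRHS]Rintegral_itv_obnd_cbnd; last exact: int.
apply: ge0_le_Rintegral int _ => // v /=.
by rewrite in_itv/= => v01; rewrite !mulr_ge0 ?powR_ge0// le_v.
Qed.

(** At distance [m] from the singular point [x = n - 1], the second base is at least [m]. This decay
    in [m] makes the sum over [i] of order [n^(2a)], where [j_inner_le] alone would give
    [n^(1 + a)]. *)
Lemma j_inner_le_far a n x (m : R) : 0 < a < 1 -> (1 <= n)%N -> 0 < m ->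
  x <= n%:R - 1 - m -> j_inner a n x <= n%:R `^ a * m `^ (a - 1).
Proof.
move=> /andP[a0 a1] n1 m0 xn; have n1R : 1 <= n%:R :> R by rewrite ler1n.
rewrite -[leRHS]mulr1 -[X in _ <= _ * X](@subr0 R) -Rintegral_cst_itv//.
apply: ge0_le_Rintegral (integrable_cst_itv _ _ (n%:R `^ a * m `^ (a - 1))) _ => //.
move=> v /=; rewrite in_itv/= => v01; split => //; first by rewrite mulr_ge0 ?powR_ge0.
by rewrite ler_pM ?powR_ge0//; [rewrite ler_powR_nneg//; lra|rewrite ler_powR_npos//; lra].
Qed.

(** The first base is at least [n - 1] and the second at most [n], with a negative exponent. The
    strict bound on [x] keeps the base [n - 1 - x] of the constant majorant positive. *)
Lemma j_inner_ge a n x : 0 < a < 1 -> 0 <= x < n%:R - 1 ->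
  (n%:R - 1) `^ a * n%:R `^ (a - 1) <= j_inner a n x.
Proof.
move=> /andP[a0 a1] xn.
rewrite -[leLHS]mulr1 -[X in _ * X <= _](@subr0 R) -Rintegral_cst_itv//.
apply: (@ge0_le_Rintegral _ _ _ _ _ _ _
  (cst (n%:R `^ a * (n%:R - 1 - x) `^ (a - 1)))) => //.
  exact: integrable_cst_itv.
move=> v /=; rewrite in_itv/= => v01.
have le1 : (n%:R - 1) `^ a <= (v + n%:R - 1) `^ a by rewrite ler_powR_nneg//; lra.
have le2 : (v + n%:R - 1) `^ a <= n%:R `^ a by rewrite ler_powR_nneg//; lra.
have le3 : n%:R `^ (a - 1) <= (v + n%:R - 1 - x) `^ (a - 1).
  by rewrite ler_powR_npos//; lra.
have le4 : (v + n%:R - 1 - x) `^ (a - 1) <= (n%:R - 1 - x) `^ (a - 1).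
  by rewrite ler_powR_npos//; lra.
by split; rewrite ?mulr_ge0 ?powR_ge0// ler_pM ?powR_ge0.
Qed.

Lemma g_inner_le a n x : 0 < a < 1 -> (1 <= n)%N -> n%:R - 1 <= x <= n%:R ->
  g_inner a n x <= n%:R `^ a / a.
Proof.
move=> /andP[a0 a1] n1 xn; have n1R : 1 <= n%:R :> R by rewrite ler1n.
apply: le_trans (Rintegral_cst_powR01_le a _ a0 (powR_ge0 _ _)).
apply: ge0_le_Rintegral (integrable_cst_powR01 a _ a0) _ => // y /=.
rewrite in_itv/= => /andP[y0 y1]; split; rewrite ?mulr_ge0 ?powR_ge0//.
rewrite ler_wpM2r ?powR_ge0// ler_powR_nneg//; nra.
Qed.

End kernel_bounds.

(** * Growth of the kernels and of their sums in [n] *)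

Section kernel_sums.
Context {R : realType}.
Implicit Types (a : R) (n : nat).

(** The growth [n^a] of the inner integral is compensated by the weight: for [n >= 2] the bound is
    [(n / (n - 1))^a / a], and [(n / (n - 1))^a <= 2^a <= 2]. For [n = 1] the factor 2 comes from
    the integral of the weight. *)
Lemma g_kernel_le a n : 0 < a < 1 / 2 -> (1 <= n)%N -> g_kernel a n <= 2 / a.
Proof.
move=> a01 n1; have [a0 a12] := andP a01.
have E : g_kernel a n = \int[@lebesgue_measure R]_(x in `[n%:R - 1, n%:R])
    (x `^ (- a) * ((n%:R - x) `^ a * g_inner a n x)).
  by apply: eq_Rintegral => x _; rewrite mulrA.
have fP x : n%:R - 1 <= x <= n%:R ->
    0 <= (n%:R - x) `^ a * g_inner a n x <= n%:R `^ a / a.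
  move=> xn; rewrite mulr_ge0 ?powR_ge0 ?g_inner_ge0//= -[leRHS]mul1r.
  rewrite ler_pM ?powR_ge0 ?g_inner_ge0//; last by rewrite g_inner_le//; lra.
  by rewrite -[leRHS](congr1 (@^~ a) (@powR1 R)) ler_powR_nneg//; lra.
have a0' : 0 <= a by exact: ltW.
case: n n1 E fP => // -[_|n _] -> fP.
  apply: le_trans (Rintegral_powRN_le _ _ _ _ _ _ fP) _ => //; first by lra.
  by rewrite powR1 div1r.
apply: le_trans (Rintegral_powRN_le_far _ _ _ _ a0' _ fP) _ => //.
rewrite mulrA ler_wpM2r ?invr_ge0//.
have n1 : 1 <= n.+2%:R - 1 :> R by rewrite lerBrDr -[leLHS]/(2%:R) ler_nat.
have n0 : 0 < n.+2%:R - 1 :> R by lra.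
rewrite powRN mulrC ler_pdivrMr ?powR_gt0//.
apply: (@le_trans _ _ ((2 * (n.+2%:R - 1)) `^ a)); first by rewrite ler_powR_nneg//; lra.
rewrite powRM ?(ltW n0)//.
rewrite ler_wpM2r ?powR_ge0//; have := @ler1_powR R 2 a.
by apply; lra.
Qed.

(* Weighted AM-GM on [n^a * (n + 1)^(1 - a)]. *)
Lemma powRB1_sub a n : 0 < a < 1 -> n%:R `^ a <= n.+1%:R `^ a - a * n.+1%:R `^ (a - 1).
Proof.
move=> /andP[a0 a1]; set y : R := n.+1%:R; have y0 : 0 < y by rewrite ltr0n.
have b0 : 0 < 1 - a by lra.
have young : n%:R `^ a * y `^ (1 - a) <= n%:R * a + y * (1 - a).
  have := @conjugate_powR R (n%:R `^ a) (y `^ (1 - a)) a^-1 (1 - a)^-1.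
  rewrite !powR_ge0 !invr_gt0 !invrK a0 b0 subrKC => /(_ isT isT isT isT erefl).
  by rewrite -!powRrM !divff ?gt_eqF// !powRr1 ?ler0n.
have -> : n%:R `^ a = y `^ (a - 1) * (n%:R `^ a * y `^ (1 - a)).
  rewrite mulrCA -powRD; last by apply/implyP => _; rewrite gt_eqF.
  by rewrite (_ : a - 1 + (1 - a) = 0) ?powRr0 ?mulr1//; lra.
apply: (@le_trans _ _ (y `^ (a - 1) * (y - a))).
  rewrite ler_wpM2l ?powR_ge0//; apply: le_trans young _.
  by rewrite /y -natr1; lra.
by rewrite mulrBr [_ * y]mulrC mulr_powRB1 ?(ltW y0)// [_ * a]mulrC.
Qed.

(** By [powRB1_sub], [a i^(a - 1) <= i^a - (i - 1)^a], and the right-hand sides telescope. *)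
Lemma sum_powRB1_le a n : 0 < a < 1 ->
  \sum_(1 <= i < n.+1) i%:R `^ (a - 1) <= n%:R `^ a / a.
Proof.
move=> a01; have /andP[a0 _] := a01; elim: n => [|n IH].
  by rewrite big_geq// divr_ge0 ?powR_ge0// ltW.
rewrite big_nat_recr//=; apply: le_trans (lerD IH (lexx _)) _.
by rewrite ler_pdivlMr// mulrDl divfK ?gt_eqF//; have := powRB1_sub a n a01; lra.
Qed.

(** The interval of the term [i = n - 1] touches the singularity, so that term is bounded by
    [j_inner_le]. Each other one lies at distance [n - 1 - i] and is bounded by [j_inner_le_far];
    these bounds add up to [2 n^(2a) / a]. *)
Lemma j_kernel_sum_le a n : 0 < a < 1 / 2 -> (1 <= n)%N ->
  \sum_(1 <= i < n) j_kernel a n i <= 4 / a * (n%:R `^ a * n%:R `^ a).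
Proof.
move=> a01; have [a0 a12] := andP a01; have a0' := ltW a0.
have a1 : 0 < a < 1 by lra.
case: n => // -[_|n _].
  by rewrite big_geq// !mulr_ge0 ?powR_ge0 ?invr_ge0.
set s := n.+2%:R `^ a.
have s1 : 1 <= s by rewrite -(@powRr0 R n.+2%:R) ler_powR// ler1n.
rewrite big_nat_recr//=.
have last_le : j_kernel a n.+2 n.+1 <= 2 * (s / a).
  apply: Rintegral_powRN_le => //; first by rewrite a0'.
  move=> x xn; rewrite j_inner_ge0 j_inner_le//.
  by rewrite -[n.+2%:R]natr1; lra.
have sum_le : \sum_(1 <= i < n.+1) j_kernel a n.+2 i <= 2 * (s * (s / a)).
  apply: (@le_trans _ _ (\sum_(1 <= i < n.+1) (2 * s) * (n.+1 - i)%:R `^ (a - 1))).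
    rewrite big_nat [leRHS]big_nat; apply: ler_sum => i /andP[i1 iN].
    rewrite -mulrA; apply: Rintegral_powRN_le => //; first by rewrite a0'.
    move=> x xi; rewrite j_inner_ge0 j_inner_le_far//.
      by rewrite ltr0n subn_gt0.
    by rewrite natrB ?(ltnW iN)// -[n.+2%:R]natr1; lra.
  (* Reversing the order of summation makes the distance to the singularity the summation index. *)
  rewrite -mulr_sumr -mulrA ler_wpM2l// ler_wpM2l ?powR_ge0// big_nat_rev/=.
  apply: (@le_trans _ _ (\sum_(1 <= i < n.+1) i%:R `^ (a - 1))).
    rewrite big_nat [leRHS]big_nat; apply: ler_sum => i /andP[i1 iN].
    by rewrite add1n subSS subKn// ltnW.
  apply: le_trans (sum_powRB1_le a n a1) _.
  by rewrite ler_wpM2r ?invr_ge0// ler_powR_nneg// ler_nat -addn2 leq_addr.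
apply: le_trans (lerD sum_le last_le) _.
rewrite -subr_ge0; have -> : 4 / a * (s * s) - (2 * (s * (s / a)) + 2 * (s / a)) =
  2 * (s / a * (s - 1)) by ring.
by rewrite !mulr_ge0 ?invr_ge0 ?subr_ge0 ?powR_ge0.
Qed.

(** Each of the [n - 3] terms with [2 <= i <= n - 2] is at least [n^(a - 1)], because
    [i^(- a) (n - 1)^a >= 1]. Moreover [n - 3 >= n / 4] as soon as [n >= 4]. *)
Lemma j_kernel_sum_ge a n : 0 < a < 1 / 2 -> (4 <= n)%N ->
  n%:R `^ a / 4 <= \sum_(1 <= i < n) j_kernel a n i.
Proof.
move=> a01 n4; have [a0 a12] := andP a01; have a0' := ltW a0.
have a1 : 0 < a < 1 by lra.
have n4R : 4 <= n%:R :> R by rewrite ler_nat.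
case: n n4 n4R => // -[//|n] n4 n4R.
have n1R : n.+1%:R = n.+2%:R - 1 :> R by rewrite -[n.+2%:R]natr1; lra.
rewrite big_nat_recr//= big_ltn//; last exact: (ltnW (n4 : (2 <= n)%N)).
(* The two extreme terms are dropped: the lower bounds are available for [2 <= i] and for [x]
   strictly below the singular point. *)
apply: (@le_trans _ _ (\sum_(2 <= i < n.+1) j_kernel a n.+2 i)); last first.
  by rewrite ler_wpDr ?j_kernel_ge0// ler_wpDl ?j_kernel_ge0.
apply: (@le_trans _ _ (\sum_(2 <= i < n.+1) n.+2%:R `^ (a - 1))).
  rewrite sumr_const_nat -[leRHS]mulr_natr -(mulr_powRB1 (ler0n _ _) a0).
  rewrite mulrAC mulrC ler_wpM2l ?powR_ge0//.
  by rewrite natrB ?(leq_trans _ (n4 : (3 <= n.+1)%N))//; lra.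
rewrite big_nat [leRHS]big_nat; apply: ler_sum => i /andP[i2 iN].
have iR : i%:R <= n.+2%:R - 2 :> R.
  by rewrite lerBrDr -natrD ler_nat addn2.
have i2R : 2 <= i%:R :> R by rewrite ler_nat.
apply: le_trans (Rintegral_powRN_ge a ((n.+2%:R - 1) `^ a * n.+2%:R `^ (a - 1))
  (n.+2%:R `^ a / a) i _ a0' i2 _ _).
- rewrite mulrA -[leLHS]mul1r ler_wpM2r ?powR_ge0// powRN mulrC.
  by rewrite ler_pdivlMr ?mul1r ?powR_gt0//; [rewrite ler_powR_nneg//|]; lra.
- by rewrite mulr_ge0 ?powR_ge0.
- by move=> x xi; rewrite j_inner_ge ?j_inner_le//; lra.
Qed.

End kernel_sums.

(** * Comparisons that hold for all large [N] *)

Lemma near_lt_powR {R : realType} (c M : R) : 0 < c ->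
  \forall N \near \oo, M < N%:R `^ c.
Proof.
move=> c0; near=> N.
apply: (@le_lt_trans _ _ ((Num.max M 0 `^ c^-1) `^ c)).
  by rewrite -powRrM mulVf ?gt_eqF// powRr1 ?le_max ?lexx ?orbT.
rewrite gt0_ltr_powR ?nnegrE ?powR_ge0//.
by near: N; exact: nbhs_infty_gtr.
Unshelve. all: by end_near. Qed.

(** This keeps the price positive, uniformly over all times up to [N]. The left side is at most
    [(6 K / a) N^(2a)], with [6 = 4 + 2] from the two kernel bounds, and the right side is
    [N^(2a) N^(1/2 - a)]. *)
Lemma near_kernel_sum_lt {R : realType} (a K : R) : 0 < a < 1 / 2 -> 0 < K ->
  \forall N \near \oo, forall n, (1 <= n <= N)%N ->
    K * (\sum_(1 <= i < n) j_kernel a n i + g_kernel a n) < N%:R `^ (a + 1 / 2).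
Proof.
move=> a01 K0; have [a0 a12] := andP a01.
near=> N => n /andP[n1 nN].
have N1 : 1 <= N%:R :> R by rewrite ler1n (leq_trans n1).
have N0 : 0 < N%:R :> R by exact: lt_le_trans N1.
set s := N%:R `^ a.
have s1 : 1 <= s by rewrite -(@powRr0 R N%:R) ler_powR ?(ltW a0).
have ns : n%:R `^ a <= s by rewrite ler_powR_nneg ?ler_nat// ltW.
have -> : N%:R `^ (a + 1 / 2) = s * s * N%:R `^ (1 / 2 - a).
  rewrite -!powRD; do ?by apply/implyP => _; rewrite gt_eqF.
  by congr (_ `^ _); lra.
apply: (@le_lt_trans _ _ (s * s * (6 / a * K))); last first.
  rewrite ltr_pM2l ?mulr_gt0 ?(lt_le_trans ltr01 s1)//.
  by near: N; apply: near_lt_powR; lra.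
rewrite mulrA [leRHS]mulrC ler_wpM2l ?(ltW K0)//.
apply: le_trans (lerD (j_kernel_sum_le _ _ a01 n1) (g_kernel_le _ _ a01 n1)) _.
have ss : n%:R `^ a * n%:R `^ a <= s * s by rewrite ler_pM ?powR_ge0.
have ai : 0 < a^-1 by rewrite invr_gt0.
have ss1 : 1 <= s * s by nra.
by nra.
Unshelve. all: by end_near. Qed.

(** This makes the gain exceed the transaction cost. With [s = N^a], the left side is
    [lambda_N s sqrt N], eventually at most [K s / 16], while the right side is at least
    [K (s / 4 - 2 / a)], which exceeds [K s / 8] once [s > 16 / a]. *)
Lemma near_cost_lt {R : realType} (a K : R) (lambda : nat -> R) :
  0 < a < 1 / 2 -> 0 < K ->
  lambda =o_\oo (fun N : nat => 1 / Num.sqrt (N%:R : R)) ->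
  \forall N \near \oo, lambda N * N%:R `^ (a + 1 / 2) <
    K * (\sum_(1 <= i < N) j_kernel a N i - g_kernel a N).
Proof.
move=> a01 K0 /eqoP lambda_o; have [a0 a12] := andP a01.
have K16 : 0 < K / 16 by rewrite divr_gt0.
near=> N.
have N4 : (4 <= N)%N by near: N; exact: nbhs_infty_ge.
have N0 : 0 < N%:R :> R by rewrite ltr0n (leq_trans _ N4).
set s := N%:R `^ a; have s0 : 0 < s by rewrite powR_gt0.
have -> : N%:R `^ (a + 1 / 2) = s * Num.sqrt N%:R.
  rewrite -powR12_sqrt ?ler0n// -powRD; last by apply/implyP => _; rewrite gt_eqF.
  by rewrite div1r.
have sqrt0 : 0 < Num.sqrt N%:R :> R by rewrite sqrtr_gt0.
have lamN : lambda N <= K / 16 * (1 / Num.sqrt N%:R).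
  apply: le_trans (ler_norm _) _.
  rewrite -[X in _ * X]ger0_norm; last by rewrite divr_ge0 ?ltW.
  by near: N; exact: lambda_o.
apply: (@le_lt_trans _ _ (K / 16 * s)).
  apply: (@le_trans _ _ (K / 16 * (1 / Num.sqrt N%:R) * (s * Num.sqrt N%:R))).
    by rewrite ler_wpM2r// mulr_ge0// ltW.
  by rewrite -mulrA [1 / _ * _]mulrCA divfK ?gt_eqF// mulr1.
have sbig : 16 / a < s by rewrite /s; near: N; exact: near_lt_powR.
apply: (@lt_le_trans _ _ (K * (s / 4 - 2 / a))).
  by rewrite -mulrA ltr_pM2l//; lra.
rewrite ler_wpM2l ?(ltW K0)// lerB//; first exact: j_kernel_sum_ge.
by apply: g_kernel_le => //; exact: leq_trans N4.
Unshelve. all: by end_near. Qed.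

(** * Measurability of the model with respect to the filtration *)

Section adaptedness.
Context {R : realType} {d : measure_display} {T : measurableType d}.
Context {P : probability T R}.
Variables (xi : nat -> {RV P >-> R}) (n : int).

(** The generating family of [filtration_of], named so that [T] can carry the sigma-algebra at time
    [n] as its measurable structure [Tn]. Adaptedness then becomes measurability of functions on
    [Tn]. *)
Definition filtration_generators : set (set T) :=
  \bigcup_(i in [set i : nat | (1 <= i)%N /\ i%:Z <= n]) g_sigma_algebra_preimage (xi i).

Local Notation Tn := (g_sigma_algebraType filtration_generators).

Lemma filtration_preimage (f : Tn -> R) (B : set R) :
  measurable_fun setT f -> measurable B -> filtration_of xi n (f @^-1` B).
Proof. by move=> mf mB; have := mf measurableT _ mB; rewrite setTI. Qed.

Lemma filtration_measurable (A : set T) : filtration_of xi n A -> measurable A.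
Proof.
apply: smallest_sub; first exact: sigma_algebra_measurable.
move=> _ [i _ [B mB <-]]; exact: (measurable_funP (xi i)).
Qed.

Lemma measurable_xi (i : nat) : (1 <= i)%N -> i%:Z <= n ->
  measurable_fun setT (xi i : Tn -> R).
Proof.
move=> i1 iN _ B mB; apply: sub_sigma_algebra; exists i => //.
by exists B.
Qed.

Lemma measurable_sum_xi (c : nat -> R) (k : nat) : k%:Z <= n ->
  measurable_fun setT ((fun w => \sum_(1 <= i < k.+1) c i * xi i w) : Tn -> R).
Proof.
elim: k => [|k IH] kn.
  by rewrite (_ : (fun _ => _) = cst 0)//; apply/funext => w; rewrite big_geq.
rewrite (_ : (fun _ => _) = (fun w : Tn =>
    \sum_(1 <= i < k.+1) c i * xi i w + c k.+1 * xi k.+1 w)); last first.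
  by apply/funext => w; rewrite big_nat_recr.
apply: measurable_funD; last by apply: measurable_funM => //; exact: measurable_xi.
by apply: IH; apply: le_trans kn; rewrite lez_nat.
Qed.

Lemma measurable_X (H sigma : R) (k : nat) : (1 <= k)%N -> k%:Z <= n ->
  measurable_fun setT (X H sigma xi k : Tn -> R).
Proof.
case: k => // k _ kn; apply: measurable_funD.
  by apply: measurable_sum_xi; apply: le_trans kn; rewrite lez_nat.
by apply: measurable_funM => //; exact: measurable_xi.
Qed.

Lemma measurable_fbm_stock (H sigma s0 : R) (N k : nat) : k%:Z <= n ->
  measurable_fun setT (fbm_stock H sigma s0 xi N k : Tn -> R).
Proof.
elim: k => [|k IH] kn /=; first exact: measurable_cst.
apply: measurable_funM; last by apply: IH; apply: le_trans kn; rewrite lez_nat.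
apply: measurable_funD => //; apply: measurable_funM => //.
exact: measurable_X.
Qed.

Lemma filtration_all_down (k : nat) : k%:Z <= n -> filtration_of xi n (all_down xi k).
Proof.
move=> kn; rewrite (_ : all_down xi k =
    \bigcap_(i in [set i | (1 <= i <= k)%N]) xi i @^-1` [set -1]); last first.
  by apply/seteqP; split => w /= wE i; exact: wE.
apply: (@bigcap_measurableType _ Tn) => i /= /andP[i1 ik].
apply: filtration_preimage => //; apply: measurable_xi => //.
by apply: le_trans kn; rewrite lez_nat.
Qed.

Lemma measurable_indic_all_down (k : nat) : k%:Z <= n ->
  measurable_fun setT (\1_(all_down xi k) : Tn -> R).
Proof. by move=> kn; apply: measurable_indic; exact: filtration_all_down. Qed.

End adaptedness.

(** * The short-selling strategy: admissibility, gain and arbitrage *)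

Section short_selling.
Context {R : realType} {d : measure_display} {T : measurableType d}.
Context {P : probability T R}.
Variables (H sigma s0 : R) (xi : nat -> {RV P >-> R}).
Local Notation S := (fbm_stock H sigma s0 xi).
Local Notation phi N lambda := (phiN H sigma s0 xi N lambda N).

(** The strategy vanishes up to time [N - 2], and from [N - 1] on the event that triggers it is
    known. The price at time [N] enters only at time [N]. *)
Lemma phiN_adapted (N : nat) (lambda : R) : (1 < N)%N ->
  adapted (filtration_of xi) N (bond (phi N lambda)) /\
  adapted (filtration_of xi) N (stock (phi N lambda)).
Proof.
case: N => // N _; split => n /andP[n1 nN] B mB; apply: filtration_preimage => //=.
  have mE : N%:Z <= n -> measurable_fun setT
      (\1_(all_down xi N) : g_sigma_algebraType (filtration_generators xi n) -> R).
    exact: measurable_indic_all_down.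
  have mS := measurable_fbm_stock xi n H sigma s0 N.+1.
  have [_|nN2] := leP n (N.+1%:Z - 2); first exact: measurable_cst.
  have {}nN2 : N%:Z <= n by lia.
  have [_|nN1] := eqVneq n (N.+1%:Z - 1).
    apply: measurable_funM; last exact: mE.
    by apply: measurable_funM => //; exact: mS.
  have {}nN1 : N.+1%:Z <= n by lia.
  apply: measurable_funM; last exact: mE.
  apply: measurable_funB; last exact: (mS N.+1 nN1).
  by apply: measurable_funM => //; exact: mS.
have [nN1|_] := eqVneq n (N.+1%:Z - 1); last exact: measurable_cst.
apply: measurableT_comp => //; apply: measurable_indic_all_down; lia.
Qed.

Lemma phiN_self_financing (N : nat) (lambda : R) : (1 < N)%N ->
  self_financing (filtration_of xi) N (S N) lambda (phi N lambda).
Proof.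
move=> N1; have [adb ads] := phiN_adapted N lambda N1; split => // n w nN /=.
set E : R := \1_(all_down xi N.-1) w.
have E0 : 0 <= E by rewrite /E indicE ler0n.
have maxE : Num.max E 0 = E by exact: max_idPl.
have maxNE : Num.max (- E) 0 = 0 by apply/max_idPr; rewrite oppr_le0.
(* At time [N] the short position is closed at the price [S_N]; the budget constraint holds with
   equality here and in the two cases below. *)
have [->|n_neq] := eqVneq n N.
  have -> : (N%:Z == N%:Z - 1) = false by lia.
  have -> : (N%:Z <= N%:Z - 2) = false by lia.
  have -> : (N%:Z - 1 <= N%:Z - 2) = false by lia.
  rewrite eqxx sub0r opprK /pos_part /neg_part.
  rewrite maxE maxNE mulr0 mul0r addr0.
  by rewrite -mulrBl addrAC subrr add0r mulNr mulrC mulNr.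
(* At time [N - 1] one share is sold short for [(1 - lambda) S_(N-1)]; before that nothing is
   traded. *)
have [nE|n_neq1] := eqVneq n N.-1.
  have -> : (n%:Z == N%:Z - 1) = true by lia.
  have -> : (n%:Z - 1 == N%:Z - 1) = false by lia.
  have -> : (n%:Z <= N%:Z - 2) = false by lia.
  have -> : (n%:Z - 1 <= N%:Z - 2) = true by lia.
  rewrite !subr0 /pos_part /neg_part opprK maxE maxNE.
  by rewrite oppr0 mul0r add0r nE mulrAC.
have -> : (n%:Z == N%:Z - 1) = false by lia.
have -> : (n%:Z - 1 == N%:Z - 1) = false by lia.
have -> : (n%:Z <= N%:Z - 2) = true by lia.
have -> : (n%:Z - 1 <= N%:Z - 2) = true by lia.
by rewrite /pos_part /neg_part subrr oppr0 maxxx oppr0 mulr0 !mul0r addr0.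
Qed.

Lemma X_down (n : nat) (w : T) : (forall i, (1 <= i < n)%N -> xi i w = -1) ->
  X H sigma xi n w = - (\sum_(1 <= i < n) j H sigma n i) + g H sigma n * xi n w.
Proof.
move=> down; rewrite /X -sumrN; congr (_ + _).
by apply: eq_big_nat => i ik; rewrite (down i ik); exact: mulrN1.
Qed.

(** Along a path of down moves [X_n] equals minus the bounded sum, so each factor [1 + X_n / N^H] is
    positive. *)
Lemma fbm_stock_gt0 (N k : nat) (w : T) : (1 <= N)%N -> 0 < s0 -> all_down xi k w ->
  (forall n, (1 <= n <= k)%N ->
    \sum_(1 <= i < n) j H sigma n i + g H sigma n < N%:R `^ H) ->
  0 < S N k w.
Proof.
move=> N1 s00; elim: k => // k IH wE bound /=.
have NH0 : 0 < N%:R `^ H :> R by rewrite powR_gt0 ?ltr0n.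
apply: mulr_gt0; last first.
  apply: IH => [i /andP[i1 ik]|n /andP[n1 nk]].
    by apply: wE; rewrite i1 ltnW.
  by apply: bound; rewrite n1 ltnW.
have -> : X H sigma xi k.+1 w =
    - (\sum_(1 <= i < k.+1) j H sigma k.+1 i + g H sigma k.+1).
  rewrite X_down => [|i /andP[i1 ik]]; last by apply: wE; rewrite i1 ltnW.
  by rewrite opprD wE ?leqnn//; congr (_ + _); exact: mulrN1.
rewrite mulNr subr_gt0 ltr_pdivrMr// mul1r; apply: bound.
by rewrite leqnn.
Qed.

Lemma liquidation_phiN (N : nat) (lambda : R) (w : T) :
  liquidation (S N) lambda (phi N lambda) N w = bond (phi N lambda) N w.
Proof.
rewrite /liquidation /=; have -> : (N%:Z == N%:Z - 1) = false by lia.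
by rewrite /pos_part /neg_part oppr0 maxxx mulr0 !mul0r addr0 subr0.
Qed.

Lemma liquidation_phiN_gt0 (N : nat) (lambda : R) (w : T) : (1 < N)%N -> 0 < s0 ->
  0 <= g H sigma N ->
  (forall n, (1 <= n < N)%N ->
    \sum_(1 <= i < n) j H sigma n i + g H sigma n < N%:R `^ H) ->
  lambda * N%:R `^ H < \sum_(1 <= i < N) j H sigma N i - g H sigma N ->
  xi N w = 1 \/ xi N w = -1 ->
  all_down xi N.-1 w -> 0 < liquidation (S N) lambda (phi N lambda) N w.
Proof.
move=> N1 s00 g0 bound cost xiN wE; rewrite liquidation_phiN /=.
have -> : (N%:Z == N%:Z - 1) = false by lia.
have -> : (N%:Z <= N%:Z - 2) = false by lia.
rewrite indicE mem_set// mulr1.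
case: N N1 g0 bound cost xiN wE => // N N1 g0 bound cost xiN wE /=.
have S0 : 0 < S N.+1 N w by apply: fbm_stock_gt0.
(* The gain factors as [S_(N-1)] times [(1 - lambda) - (1 + X_N / N^H)], so the claim reduces to
   [X_N / N^H < - lambda], whatever the last sign is. *)
rewrite -mulrBl pmulr_lgt0//.
have NH0 : 0 < N.+1%:R `^ H :> R by rewrite powR_gt0 ?ltr0n.
have X_lt : X H sigma xi N.+1 w < - (lambda * N.+1%:R `^ H).
  rewrite X_down => [|i]; last exact: wE.
  have gxi : g H sigma N.+1 * xi N.+1 w <= g H sigma N.+1.
    by apply: ler_piMr => //; case: xiN => ->; lra.
  lra.
have : X H sigma xi N.+1 w / N.+1%:R `^ H < - lambda by rewrite ltr_pdivrMr// mulNr.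
lra.
Qed.

Lemma liquidation_phiN_eq0 (N : nat) (lambda : R) (w : T) :
  ~ all_down xi N.-1 w -> liquidation (S N) lambda (phi N lambda) N w = 0.
Proof.
move=> wE; rewrite liquidation_phiN /=.
have -> : (N%:Z == N%:Z - 1) = false by lia.
have -> : (N%:Z <= N%:Z - 2) = false by lia.
by rewrite indicE memNset// mulr0.
Qed.

(** The two values are taken on disjoint events of probability 1/2 each, so the complement of their
    union is null. *)
Lemma iid_signs_ae (n : nat) : iid_signs xi -> (1 <= n)%N ->
  {ae P, forall w, xi n w = 1 \/ xi n w = -1}.
Proof.
move=> [xi_law _] n1; have [P1 PN1] := xi_law n n1.
have mxi (x : R) : measurable (xi n @^-1` [set x]).
  by rewrite -[X in measurable X]setTI; exact: measurable_funP.
exists (~` (xi n @^-1` [set 1] `|` xi n @^-1` [set -1])); split.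
- by apply: measurableC; exact: measurableU.
- rewrite probability_setC; last exact: measurableU.
  rewrite measureU//.
    rewrite [X in (1 - X)%E](congr2 +%R P1 PN1).
    by rewrite -EFinD -splitr subrr.
  by apply/seteqP; split => w // [/= -> /eqP]; rewrite -addr_eq0 -[1 + 1]/(2%:R) pnatr_eq0.
- by move=> w /= wN [w1|w1]; apply: wN; [left|right].
Qed.

(** By independence the probability is a product of [n] factors 1/2. *)
Lemma iid_signs_all_down_gt0 (n : nat) : iid_signs xi -> (0 < P (all_down xi n))%E.
Proof.
move=> [xi_law xi_ind].
have -> : all_down xi n = \bigcap_(i in [set` iota 1 n]) xi i @^-1` [set -1].
  apply/seteqP; split => w /= wE i.
    by rewrite /= mem_iota => i1n; apply: wE; rewrite -ltnS.
  by move=> i1n; apply: wE; rewrite /= mem_iota.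
rewrite (xi_ind _ (fun=> [set -1])) ?iota_uniq//; last first.
  by move=> i /=; rewrite mem_iota => /andP[].
rewrite big_seq; apply: (big_ind (fun x : \bar R => 0 < x)%E) => [|x y|i].
- exact: lte01.
- exact: mule_gt0.
- by rewrite mem_iota => /andP[i1 _]; have [_ ->] := xi_law i i1; rewrite lte_fin; lra.
Qed.

Lemma phiN_arbitrage (N : nat) (lambda : R) : iid_signs xi -> (1 < N)%N -> 0 < s0 ->
  0 <= g H sigma N ->
  (forall n, (1 <= n < N)%N ->
    \sum_(1 <= i < n) j H sigma n i + g H sigma n < N%:R `^ H) ->
  lambda * N%:R `^ H < \sum_(1 <= i < N) j H sigma N i - g H sigma N ->
  is_arbitrage P (filtration_of xi) N (S N) lambda (phi N lambda).
Proof.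
move=> xi_iid N1 s00 g0 bound cost.
have gt0 := liquidation_phiN_gt0 N lambda _ N1 s00 g0 bound cost.
split.
- exact: phiN_self_financing.
- move=> w /=.
  have -> : (-1 <= N%:Z - 2) = true by lia.
  by have -> : (-1 == N%:Z - 1) = false by lia.
- apply: filterS (iid_signs_ae N xi_iid (ltnW N1)) => w xiN.
  have [wE|wE] := pselect (all_down xi N.-1 w); first by rewrite ltW// gt0.
  by rewrite liquidation_phiN_eq0.
(* The event that all [N] signs are -1 lies in the triggering event and fixes the last sign, so the
   gain is strictly positive at each of its points. *)
- apply: lt_le_trans (iid_signs_all_down_gt0 N xi_iid) _.
  apply: le_measure; rewrite ?inE//=.
  + by apply: (filtration_measurable xi N%:Z); exact: filtration_all_down.
  + rewrite (_ : mkset _ = bond (phi N lambda) N%:Z @^-1` `]0, +oo[); last first.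
      by apply/seteqP; split => w; rewrite /= liquidation_phiN in_itv/= andbT.
    apply: (filtration_measurable xi N%:Z).
    have [adb _] := phiN_adapted N lambda N1.
    by apply: adb => //; lia.
  move=> w wE /=; apply: gt0.
    by right; apply: wE; rewrite leqnn ltnW.
  by move=> i /andP[i1 iN]; apply: wE; rewrite i1 (leq_trans iN)// leq_pred.
Qed.

End short_selling.

(** * Positivity of the normalizing constant and choice of [N] *)

Theorem theorem3p1 (R : realType) (d : measure_display) (T : measurableType d)
    (P : probability T R) (H sigma s0 : R) (xi : nat -> {RV P >-> R})
    (nH : nat) (lambda : nat -> R)
    (H_gt : 1 / 2 < H) (H_lt : H < 1) (sigma_gt0 : 0 < sigma) (s0_gt0 : 0 < s0)
    (xi_iid : iid_signs xi)
    (nH_ge1 : (1 <= nH)%N)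
    (nH_spec : forall n : nat, (nH <= n)%N ->
       - (\sum_(1 <= i < n) j H sigma n i) + g H sigma n < 0)
    (lambda01 : forall N : nat, (1 <= N)%N -> 0 <= lambda N <= 1)
    (lambda_o : lambda =o_\oo (fun N : nat => 1 / Num.sqrt (N%:R : R))) :
  \forall N \near \oo,
    (nH <= N)%N /\ (1 < N)%N /\
    is_arbitrage P (filtration_of xi) N (fbm_stock H sigma s0 xi N) (lambda N)
      (phiN H sigma s0 xi N (lambda N) N).
Proof.
pose a := H - 1 / 2; pose K := sigma * cH H * a.
have a01 : 0 < a < 1 / 2 by apply/andP; split; rewrite /a; lra.
have Ha : H = a + 1 / 2 by rewrite /a subrK.
have sumE n : \sum_(1 <= i < n) j H sigma n i = K * \sum_(1 <= i < n) j_kernel a n i.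
  by rewrite mulr_sumr; apply: eq_bigr => i _; exact: jE.
(* If the constant [K] vanished, so would the left-hand side of [nH_spec]; this
   spares the proof that the [Gamma] integrals in [cH H] are finite. *)
have K0 : 0 < K.
  rewrite lt_neqAle eq_sym; apply/andP; split; last first.
    by case/andP: a01 => a0 _; rewrite !mulr_ge0 ?sqrtr_ge0// ltW.
  apply/eqP => KE; have := nH_spec nH (leqnn nH).
  by rewrite sumE gE -/a -/K KE !mul0r oppr0 addr0 ltxx.
have bound := near_kernel_sum_lt a K a01 K0.
have cost := near_cost_lt a K lambda a01 K0 lambda_o.
near=> N; split; first by near: N; exact: nbhs_infty_ge.
have N1 : (1 < N)%N by near: N; exact: nbhs_infty_ge.
split=> //; apply: phiN_arbitrage => //.
- by rewrite gE mulr_ge0 ?g_kernel_ge0// ltW.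
(* The quantifier over [n] stays inside the eventual statement: one [N] must serve all times up to
   [N]. *)
- have boundN : forall n, (1 <= n <= N)%N ->
      K * (\sum_(1 <= i < n) j_kernel a n i + g_kernel a n) < N%:R `^ (a + 1 / 2).
    by near: N; exact: bound.
  move=> n /andP[n1 nN]; rewrite sumE gE -/a -/K -mulrDr [X in _ `^ X]Ha.
  by apply: boundN; rewrite n1 ltnW.
- by rewrite sumE gE -/a -/K -mulrBr [X in _ `^ X]Ha; near: N; exact: cost.
Unshelve. all: by end_near. Qed.
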